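(* Let $(X,\|\cdot\|)$ be a Banach space, $C\subseteq X$ a bounded closed convex set with $\kappa=\mathrm{diam}(C)$, and $T:C\to C$ a nonexpansive map. Let $(\alpha_n)_{n\ge1}$ and $(\beta_n)_{n\ge1}$ be sequences in $(0,1)$, let $x_0\in C$, and let $(x_n)_{n\in\mathbb{N}}$ be generated by $$y_n=(1-\beta_{n+1})x_n+\beta_{n+1}Tx_n,\qquad x_{n+1}=(1-\alpha_{n+1})x_n+\alpha_{n+1}Ty_n,\qquad n\in\mathbb{N}.$$ Assume that $\beta_n\to0$, $\sum_{k\ge1}\alpha_k\beta_k<\infty$, and $\sum_{k\ge1}\alpha_k(1-\alpha_k)=\infty$. Then $\|x_n-Tx_n\|\to0$ and, for all $n\in\mathbb{N}$, $$\|x_n-Tx_n\|\le\kappa\left[\sigma(\tau_n)+\sum_{i=1}^n2\,\alpha_i\beta_i\,\sigma(\tau_n-\tau_i)+2\beta_{n+1}\right].$$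
   Context: $\mathbb{N}=\{0,1,2,\dots\}$. $T$ nonexpansive means $\|Tx-Ty\|\le\|x-y\|$ for all $x,y$ in its domain. $\tau_n=\sum_{k=1}^n\alpha_k(1-\alpha_k)$ (so $\tau_0=0$). The function $\sigma:[0,\infty)\to\mathbb{R}$ is $\sigma(y)=\min\{1,1/\sqrt{\pi y}\}$, with $\sigma(0)=1$. *)

(* Defs.v *)
From HB Require Import structures.
From mathcomp Require Import all_boot all_order all_algebra.
From mathcomp Require Import all_classical all_reals all_analysis.

Set Implicit Arguments.
Unset Strict Implicit.
Unset Printing Implicit Defensive.

Import Order.TTheory GRing.Theory Num.Theory.
Import numFieldNormedType.Exports.

Local Open Scope classical_set_scope.
Local Open Scope ring_scope.

(* [sup] is only the genuine supremum when [C] is nonempty and bounded. *)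
Definition diam (R : realType) (X : normedModType R) (C : set X) : R :=
  sup [set `|u - v| | u in C & v in C].

(* [C] is the domain: the values of [T] outside [C] are irrelevant. *)
Definition nonexpansive (R : realType) (X : normedModType R) (C : set X)
    (T : X -> X) : Prop :=
  forall u v, C u -> C v -> `|T u - T v| <= `|u - v|.

Definition tau (R : realType) (alpha : nat -> R) (n : nat) : R :=
  \sum_(1 <= k < n.+1) alpha k * (1 - alpha k).

(* The case [y = 0] is separate because [0^-1 = 0]; only [0 <= y] is
   meaningful. *)
Definition sigma (R : realType) (y : R) : R :=
  if y == 0 then 1 else Num.min 1 (Num.sqrt (pi * y))^-1.

(* Main.v *)
Require Import Defs.
From HB Require Import structures.
From mathcomp Require Import all_boot all_order all_algebra.
From mathcomp Require Import all_classical all_reals all_analysis.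
From mathcomp Require Import ring lra.

Set Implicit Arguments.
Unset Strict Implicit.
Unset Printing Implicit Defensive.

Import Order.TTheory GRing.Theory Num.Theory.
Import numFieldNormedType.Exports.

Local Open Scope classical_set_scope.
Local Open Scope ring_scope.

(** The estimate holds because the iterates can be compared by a race between
two random walkers.  Put [p k = alpha k * (1 - alpha k)] and
[e k = diam C * beta k].  Since [x n.+1] is the average of [x n] and [T (y n)]
with weights [1 - alpha n.+1] and [alpha n.+1], every iterate is an average of
the images [T (y i)], and [T (y i)] differs from [T (x i)] by at most [e i.+1].
Unrolling both averages in [`|x m - x n|], for [m <= n], with independent
coins leads to the following race.  Walking down the indices, each walker
tosses at index [k] a coin with success probability [alpha k]; a success jumps
from [T (y k.-1)] to [x k.-1] and costs [e k].  If the walkers meet, the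
distance is zero; if the lower one reaches index 0 while the upper one is a
jump ahead, the distance is at most [diam C].  The number of jumps by which the
upper walker is ahead is a symmetric lazy random walk, moving by +1 or -1 with
probability [p k] each at time [k], and the walkers meet exactly when this walk
hits 0.  This gives [dist_iterate_next]: [`|x n - T (y n)|] is at most [diam C]
times the probability that the walk started at 1 survives all the times
[n, ..., 1], plus the expected costs, which involve the survival probabilities
over the times [n, ..., i.+1].  Formally the race is run backwards, by a
recursion on the lower index.

The survival probability is computed by Fourier analysis.  The function of [s]
given by [walk_kernel s t] vanishes at 0 and is an eigenfunction of the discrete
Laplacian, so a step at time [k] multiplies it by
[1 - 4 * p k * sin t ^+ 2]; averaging over [t] in [[0, pi / 2]] yields the
exact formula [survival_integral].  For the walk started at 1 the integrand is
at most [2 * cos t * expR (- 4 * v * sin t ^+ 2)], where [v] is the sum of the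
[p k], and the substitution [u = 2 * sqrt v * sin t] bounds the integral by the
Gaussian integral; this is the sharp bound [1 / sqrt (pi * v)], that is
[survival_le_sigma].

Finally [sigma] vanishes at infinity, so the bound tends to 0 by dominated
convergence for series ([cvg_weighted_sum0]). *)

(** * A killed symmetric random walk on the natural numbers *)

Section killed_walk.
Variable R : realType.
Implicit Types (f g : nat -> R) (p c a : nat -> R).

(** One step of the expectation of [f] along the walk that moves up or down
with probability [p] each, stays otherwise, and is killed at 0. *)
Definition killed_step (p : R) f (s : nat) : R :=
  if s is s'.+1 then p * (f s.+1 + f s') + (1 - 2 * p) * f s else 0.

(** Probability that the walk started at [s] avoids 0 when it makes the steps of
times [m, m.-1, ..., i.+1], of parameters [p m, ..., p i.+1]; for [m <= i] there
is no step. *)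
Fixpoint survival p (i m s : nat) : R :=
  if m is m'.+1 then
    if (i <= m')%N then killed_step (p m) (survival p i m') s else (0 < s)%N%:R
  else (0 < s)%N%:R.

Lemma survival_diag p i m s : (m <= i)%N -> survival p i m s = (0 < s)%N%:R.
Proof. by case: m => //= m mi; rewrite leqNgt mi. Qed.

Lemma survivalS p i m s : (i <= m)%N ->
  survival p i m.+1 s = killed_step (p m.+1) (survival p i m) s.
Proof. by move=> im /=; rewrite im. Qed.

Lemma survival_bounds p i m s : (forall k, (1 <= k)%N -> 0 <= p k <= 2^-1) ->
  0 <= survival p i m s <= 1.
Proof.
move=> p01; have ind01 t : 0 <= ((0 < t)%N%:R : R) <= 1.
  by case: t => [|t]; rewrite lexx ler01.
elim: m s => [//|m IH] s /=; case: ifP => // _.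
case: s => [|s] /=; first by rewrite lexx ler01.
have /andP[pm0 pm1] := p01 m.+1 isT.
have /andP[u0 u1] := IH s.+2; have /andP[v0 v1] := IH s.
have /andP[w0 w1] := IH s.+1.
have {}pm1 : 0 <= 1 - 2 * p m.+1 by lra.
apply/andP; split.
  by apply: addr_ge0; apply: mulr_ge0 => //; exact: addr_ge0.
have h1 : p m.+1 * (survival p i m s.+2 + survival p i m s) <= p m.+1 * 2.
  by apply: ler_wpM2l => //; lra.
have h2 : (1 - 2 * p m.+1) * survival p i m s.+1 <= 1 - 2 * p m.+1.
  by rewrite -[leRHS]mulr1; apply: ler_wpM2l.
lra.
Qed.

(** Expected total payment of the walk started at [s] that makes the steps of
times [m, ..., 1]: [c k] is paid at time [k] if the walk is alive just before
that step, and [kappa] at the end if it has survived. *)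
Fixpoint walk_cost (kappa : R) p c (m s : nat) : R :=
  if m is m'.+1 then
    killed_step (p m) (walk_cost kappa p c m') s + c m * (0 < s)%N%:R
  else kappa * (0 < s)%N%:R.

Lemma walk_cost0 kappa p c m : walk_cost kappa p c m 0 = 0.
Proof. by case: m => [|m] /=; rewrite !mulr0 ?addr0. Qed.

Lemma walk_costE kappa p c m s :
  walk_cost kappa p c m s = kappa * survival p 0 m s
    + \sum_(1 <= i < m.+1) c i * survival p i m s.
Proof.
elim: m s => [|m IH] s; first by rewrite big_geq //= addr0.
rewrite [LHS]/= big_nat_recr //= ltnn addrA; congr (_ + _).
rewrite (eq_big_nat _ _ (F2 := fun i =>
    c i * killed_step (p m.+1) (survival p i m) s)); last first.
  by move=> i /andP[_ im]; rewrite -ltnS im.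
case: s => [|s] /=; first by rewrite mulr0 add0r big1 // => i _; rewrite mulr0.
rewrite !IH; under eq_bigr do rewrite mulrDr mulrCA (mulrDr (c _)) mulrCA.
rewrite big_split /= -!mulr_sumr big_split /=; ring.
Qed.

(** Mean of [f (s + N)], where [N] is the number of successes among
independent coins of indices [m.+1, ..., m + d], of success probabilities
[a m.+1, ..., a (m + d)]. *)
Fixpoint jump_mean a (m d : nat) f (s : nat) : R :=
  if d is d'.+1 then
    (1 - a (m + d)%N) * jump_mean a m d' f s
    + a (m + d)%N * jump_mean a m d' f s.+1
  else f s.

(** The recursion of [jump_mean] singles out the last coin; here the first coin
is singled out instead. *)
Lemma jump_mean_first a m d f s : jump_mean a m d.+1 f s =
  jump_mean a m.+1 d (fun t => (1 - a m.+1) * f t + a m.+1 * f t.+1) s.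
Proof.
elim: d s => [|d IH] s; first by rewrite /= addn1.
by rewrite [RHS]/= -!IH addSnnS.
Qed.

Lemma jump_mean_shift a m d f s :
  jump_mean a m d f s.+1 = jump_mean a m d (f \o succn) s.
Proof. by elim: d s => //= d IH s; rewrite !IH. Qed.

Lemma jump_mean_linear a m d f g (u v w : R) s :
  jump_mean a m d (fun t => u * f t + v * g t + w) s =
  u * jump_mean a m d f s + v * jump_mean a m d g s + w.
Proof. by elim: d s => //= d IH s; rewrite !IH; ring. Qed.

Lemma eq_jump_mean a m d f g s : (forall t, (s <= t)%N -> f t = g t) ->
  jump_mean a m d f s = jump_mean a m d g s.
Proof.
elim: d s => [|d IH] s fg /=; first exact: fg.
by rewrite !IH // => t st; apply: fg => //; exact: ltnW.
Qed.

Lemma jump_mean_cst a m d (k : R) s : jump_mean a m d (fun=> k) s = k.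
Proof. by elim: d s => //= d IH s; rewrite !IH; ring. Qed.

(** Tossing coin [m.+1] once for the upper walker (inside [jump_mean]) and once
for the lower one produces one step of the walk: two independent coins of
parameter [a] differ by +1 or -1 with probability [a * (1 - a)] each.  The term
[2 * a m.+1 * e m.+1] is the expected cost of both coins. *)
Lemma jump_mean_walk_cost kappa a e m d :
  let Q := walk_cost kappa (fun k => a k * (1 - a k))
             (fun k => 2 * a k * e k) in
  (1 - a m.+1) * jump_mean a m d.+1 (Q m) 1
  + a m.+1 * jump_mean a m d.+1 (Q m) 0 + 2 * a m.+1 * e m.+1 =
  jump_mean a m.+1 d (Q m.+1) 1.
Proof.
move=> Q; rewrite !jump_mean_first !jump_mean_shift -jump_mean_linear.
apply: eq_jump_mean => t _; rewrite /Q /=; ring.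
Qed.

End killed_walk.

(** * Distances between the iterates of an averaged iteration *)

Section averaged_iteration.
Variables (R : realType) (X : normedModType R).

Lemma ler_norm_conv (a : R) (u v w : X) : 0 <= a <= 1 ->
  `|u - ((1 - a) *: v + a *: w)| <= (1 - a) * `|u - v| + a * `|u - w|.
Proof.
move=> /andP[a0 a1].
have -> : u - ((1 - a) *: v + a *: w) = (1 - a) *: (u - v) + a *: (u - w).
  rewrite !scalerBr addrACA -opprD -scalerDl subrK scale1r //.
apply: le_trans (ler_normD _ _) _.
by rewrite !normrZ !ger0_norm // subr_ge0.
Qed.

Variables (kappa : R) (a e : nat -> R) (x z : nat -> X).
Hypothesis a01 : forall k, (1 <= k)%N -> 0 <= a k <= 1.
Hypothesis e_ge0 : forall k, (1 <= k)%N -> 0 <= e k.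
Hypothesis x_rec : forall n, x n.+1 = (1 - a n.+1) *: x n + a n.+1 *: z n.
Hypothesis z_nonexpansive :
  forall i k, `|z i - z k| <= `|x i - x k| + e i.+1 + e k.+1.
Hypothesis x0z : forall k, `|x 0%N - z k| <= kappa.

Let Q := walk_cost kappa (fun k => a k * (1 - a k)) (fun k => 2 * a k * e k).
(* Expected cost of the coins [m.+1, ..., m + d] of the upper walker. *)
Let toll m d := \sum_(m.+1 <= l < (m + d).+1) a l * e l.

Let tollS m d : toll m d.+1 = toll m d + a (m + d).+1 * e (m + d).+1.
Proof. by rewrite /toll addnS big_nat_recr //= ltnS leq_addr. Qed.

Let toll_first m d : toll m d.+1 = a m.+1 * e m.+1 + toll m.+1 d.
Proof. by rewrite /toll addnS big_ltn ?ltnS ?leq_addr. Qed.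

(* The bound between [x m] and [x (m + d)] follows from the bounds between
[x m] and the images [z n], [n >= m], on unrolling the upper iterate. *)
Let dist_iterates m : 
  (forall d, `|x m - z (m + d)%N| <=
     jump_mean a m d (Q m) 1 + toll m d + e (m + d).+1) ->
  forall d, `|x m - x (m + d)%N| <= jump_mean a m d (Q m) 0 + toll m d.
Proof.
move=> H; elim=> [|d IH].
  by rewrite addn0 subrr normr0 /= /Q walk_cost0 /toll addn0 big_geq // addr0.
have /andP[a0 a1] := a01 (ltn0Sn (m + d)).
rewrite addnS x_rec; apply: le_trans (ler_norm_conv _ _ _ (a01 _)) _ => //.
rewrite tollS /= !addnS.
apply: (le_trans (lerD (ler_wpM2l _ IH) (ler_wpM2l a0 (H d)))); first lra.
by rewrite le_eqVlt; apply/orP; left; apply/eqP; ring.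
Qed.

(** Unrolling [x m.+1] leads either to [x m], or to [z m], whose distance to
[z n] is controlled by the distance between [x m] and [x n]. *)
Lemma dist_iterate_image m d : `|x m - z (m + d)%N| <=
  jump_mean a m d (Q m) 1 + toll m d + e (m + d).+1.
Proof.
elim: m d => [|m IH] d.
  rewrite (eq_jump_mean _ _ _ (g := fun=> kappa)); last first.
    by move=> [|t] //= _; rewrite /Q /= mulr1.
  rewrite jump_mean_cst -addrA; apply: le_trans (x0z _) _.
  rewrite lerDl addr_ge0 // ?e_ge0 // /toll big_nat; apply: sumr_ge0 => l.
  by move=> /andP[l0 _]; rewrite mulr_ge0 // ?e_ge0 //; case/andP: (a01 l0).
have /andP[a0 a1] := a01 (ltn0Sn m).
have := IH d.+1; have := dist_iterates IH d.+1; rewrite addnS -addSn => hD hE.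
rewrite x_rec -normrN opprB; apply: le_trans (ler_norm_conv _ _ _ (a01 _)) _ => //.
have hZ : `|z (m.+1 + d)%N - z m| <= jump_mean a m d.+1 (Q m) 0
    + toll m d.+1 + e m.+1 + e (m.+1 + d).+1.
  rewrite -normrN opprB; apply: le_trans (z_nonexpansive _ _) _.
  by rewrite !lerD2r.
rewrite -[`|_ - x m|]normrN opprB.
apply: (le_trans (lerD (ler_wpM2l _ hE) (ler_wpM2l a0 hZ))); first lra.
rewrite -jump_mean_walk_cost toll_first.
by rewrite le_eqVlt; apply/orP; left; apply/eqP; rewrite -/Q; ring.
Qed.

Lemma dist_iterate_next m : `|x m - z m| <= kappa *
    survival (fun k => a k * (1 - a k)) 0 m 1
  + \sum_(1 <= i < m.+1)
      2 * a i * e i * survival (fun k => a k * (1 - a k)) i m 1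
  + e m.+1.
Proof.
have := dist_iterate_image m 0; rewrite addn0 /= /toll addn0 (big_geq (leqnn _)) addr0.
by rewrite /Q walk_costE.
Qed.

End averaged_iteration.

(** * Integral formula for the survival probability *)

Section survival_integral.
Variable R : realType.
Implicit Types (f g : R -> R) (p : nat -> R) (t : R).
Local Notation mu := lebesgue_measure.
Local Notation I f := (\int[mu]_(t in `[0, pi / 2]) f t).

Lemma continuous_itv_integrable f (a b : R) :
  continuous f -> mu.-integrable `[a, b] (EFin \o f).
Proof.
move=> cf; apply: continuous_compact_integrable; first exact: segment_compact.
exact: continuous_subspaceT.
Qed.

Lemma continuous_cosM (k : R) : continuous (fun t => cos (k * t)).
Proof.
by move=> t; apply: continuous_comp; [exact: mulrl_continuous|exact: continuous_cos].
Qed.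

Lemma sin_natMpi (r : nat) : sin (r%:R * pi) = 0 :> R.
Proof.
elim: r => [|r IH]; first by rewrite mul0r sin0.
by rewrite -natr1 mulrDl mul1r sinDpi IH oppr0.
Qed.

Lemma Rintegral_cos_even (r : nat) : (0 < r)%N ->
  I (fun t => cos (r%:R * 2 * t)) = 0.
Proof.
move=> r0; set k : R := r%:R * 2.
have k0 : k != 0 by rewrite mulf_neq0 // pnatr_eq0 -lt0n.
have dF t : is_derive t 1 (fun t => k^-1 * sin (k * t)) (cos (k * t)).
  apply: is_derive_eq; rewrite /GRing.scale /=; by field.
have cF : continuous (fun t => k^-1 * sin (k * t)).
  by move=> t; apply/differentiable_continuous/derivable1_diffP; case: (dF t).
rewrite /Rintegral (continuous_FTC2 (F := fun t => k^-1 * sin (k * t))).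
- have -> : k * (pi / 2) = r%:R * pi by rewrite /k; field.
  by rewrite /= sin_natMpi !mulr0 sin0 mulr0 subrr.
- by rewrite divr_gt0 // pi_gt0.
- by apply: continuous_subspaceT; exact: continuous_cosM.
- split; first by move=> t _; case: (dF t).
  + by apply: cvg_at_right_filter; exact: cF.
  + by apply: cvg_at_left_filter; exact: cF.
- by move=> t _; rewrite derive1E; case: (dF t).
Qed.

(** The function [sin (2 * s * t) * cot t], written as a trigonometric
polynomial to avoid the singularity at [t = 0]. *)
Definition walk_kernel (s : nat) t : R :=
  \sum_(r < s) (cos (r%:R * 2 * t) + cos (r.+1%:R * 2 * t)).

Lemma walk_kernel1 t : walk_kernel 1 t = 2 * cos t ^+ 2.
Proof.
rewrite /walk_kernel big_ord1 !mul0r cos0 mul1r mulrC mulr_natr cos_mulr2n.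
by rewrite addrC subrK mulr_natl.
Qed.

(** In [s], the kernel is an eigenfunction of the sum over the two neighbours. *)
Lemma walk_kernel_rec s t :
  walk_kernel s.+2 t + walk_kernel s t = 2 * cos (2 * t) * walk_kernel s.+1 t.
Proof.
have C2 r : cos (r.+2%:R * 2 * t) + cos (r%:R * 2 * t)
    = 2 * cos (2 * t) * cos (r.+1%:R * 2 * t).
  have -> : r.+2%:R * 2 * t = r.+1%:R * 2 * t + 2 * t by rewrite -[r.+2%:R]natr1; ring.
  have -> : r%:R * 2 * t = r.+1%:R * 2 * t - 2 * t by rewrite -[r.+1%:R]natr1; ring.
  by rewrite cosD cosB; ring.
have c2 : cos (2 * 2 * t) = 2 * cos (2 * t) * cos (2 * t) - 1.
  by have := C2 0%N; rewrite !mul0r cos0 mul1r => <-; rewrite addrK.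
elim: s => [|s IH].
  rewrite /walk_kernel !big_ord_recr big_ord0 /= !mul0r cos0 !mul1r c2.
  by ring.
have step u : walk_kernel u.+1 t = walk_kernel u t
   + (cos (u%:R * 2 * t) + cos (u.+1%:R * 2 * t)) by rewrite /walk_kernel big_ord_recr.
rewrite (step s.+2) (step s) addrACA IH (step s.+1) addrACA.
by rewrite (C2 s) [cos (s.+3%:R * _ * _) + _]C2; ring.
Qed.

Lemma continuous_walk_kernel s : continuous (walk_kernel s).
Proof.
elim: s => [|s IH] t.
  rewrite (_ : walk_kernel 0 = cst 0); first exact: cvg_cst.
  by apply/funext => u; rewrite /walk_kernel big_ord0.
rewrite (_ : walk_kernel s.+1 = fun t => walk_kernel s t +
    (cos (s%:R * 2 * t) + cos (s.+1%:R * 2 * t))); last first.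
  by apply/funext => u; rewrite /walk_kernel big_ord_recr.
by apply: cvgD; [exact: IH|apply: cvgD; exact: continuous_cosM].
Qed.

(** This Fourier integral represents the initial condition of the survival
probability, which is 1 at positive [s] and 0 at [s = 0]. *)
Lemma Rintegral_walk_kernel s : I (walk_kernel s) = pi / 2 * (0 < s)%N%:R.
Proof.
elim: s => [|s IH].
  rewrite (_ : walk_kernel 0 = cst 0) ?Rintegral_cst ?mul0r ?mulr0 //.
  by apply/funext => u; rewrite /walk_kernel big_ord0.
rewrite (_ : walk_kernel s.+1 = fun t => walk_kernel s t +
    (cos (s%:R * 2 * t) + cos (s.+1%:R * 2 * t))); last first.
  by apply/funext => u; rewrite /walk_kernel big_ord_recr.
have cc k : mu.-integrable `[0, pi / 2] (EFin \o (fun t => cos (k * t))).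
  by apply: continuous_itv_integrable; exact: continuous_cosM.
rewrite RintegralD //; last 2 first.
- by apply: continuous_itv_integrable; exact: continuous_walk_kernel.
- apply: continuous_itv_integrable => t.
  by apply: cvgD; exact: continuous_cosM.
rewrite RintegralD // IH (Rintegral_cos_even (r := s.+1)) // addr0.
case: s {IH} => [|s]; last by rewrite Rintegral_cos_even // addr0.
rewrite mulr0 add0r (eq_Rintegral mu (g := cst 1)).
  rewrite Rintegral_cst // mul1r /= lebesgue_measure_itv /= lte_fin.
  by rewrite divr_gt0 ?pi_gt0 //= subr0 mulr1.
by move=> t _; rewrite !mul0r cos0.
Qed.

(** Product of the factors by which the steps of times [i.+1, ..., m] multiply
[walk_kernel ^~ t]. *)
Definition walk_weight p (i m : nat) t : R :=
  \prod_(i.+1 <= l < m.+1) (1 - 4 * p l * sin t ^+ 2).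

Lemma walk_weightS p i m t : (i <= m)%N -> walk_weight p i m.+1 t =
  walk_weight p i m t * (1 - 4 * p m.+1 * sin t ^+ 2).
Proof. by move=> im; rewrite /walk_weight big_nat_recr. Qed.

Lemma continuous_walk_weight p i m : continuous (walk_weight p i m).
Proof.
have base j : (j <= i)%N -> continuous (walk_weight p i j).
  move=> ji t; rewrite (_ : walk_weight p i j = cst 1); first exact: cvg_cst.
  by apply/funext => u; rewrite /walk_weight big_geq.
elim: m => [|m IH]; first exact: base.
case: (leqP i m) => im; last exact: base.
move=> t; rewrite (_ : walk_weight p i m.+1 = fun t => walk_weight p i m t *
  (1 - 4 * p m.+1 * sin t ^+ 2)); last by apply/funext => u; exact: walk_weightS.
apply: cvgM; first exact: IH.
apply: cvgB; first exact: cvg_cst.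
apply: cvgM; first exact: cvg_cst.
by rewrite expr2; apply: cvgM; exact: continuous_sin.
Qed.

Lemma survival_integral p i m s : (i <= m)%N -> survival p i m s =
  2 / pi * I (fun t => walk_kernel s t * walk_weight p i m t).
Proof.
have pi0 : (pi : R) != 0 by rewrite gt_eqF // pi_gt0.
move=> /subnKC <-; elim: (m - i)%N s => [|d IH] s.
  rewrite addn0 survival_diag // (eq_Rintegral mu (g := walk_kernel s)).
    by rewrite Rintegral_walk_kernel mulrA -[2 / pi]invf_div mulVf ?mul1r // mulf_neq0.
  by move=> t _; rewrite /walk_weight big_geq // mulr1.
rewrite addnS survivalS ?leq_addr // /killed_step.
case: s => [|s].
  rewrite (eq_Rintegral mu (g := cst 0)) ?Rintegral_cst ?mul0r ?mulr0 //.
  by move=> t _; rewrite /walk_kernel big_ord0 mul0r.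
rewrite !IH; set W := walk_weight p i (i + d).
have int u : mu.-integrable `[0, pi / 2] (EFin \o (fun t => walk_kernel u t * W t)).
  apply: continuous_itv_integrable => t.
  by apply: cvgM; [exact: continuous_walk_kernel|exact: continuous_walk_weight].
have intZ u (k : R) : mu.-integrable `[0, pi / 2]
    (EFin \o (fun t => k * (walk_kernel u t * W t))).
  apply: continuous_itv_integrable => t; apply: cvgM; first exact: cvg_cst.
  by apply: cvgM; [exact: continuous_walk_kernel|exact: continuous_walk_weight].
set q := p (i + d).+1.
transitivity (2 / pi * I (fun t => (q * (walk_kernel s.+2 t * W t)
  + q * (walk_kernel s t * W t)) + (1 - 2 * q) * (walk_kernel s.+1 t * W t))).
  rewrite RintegralD ?RintegralD ?RintegralZl //; first by ring.
  apply: continuous_itv_integrable => t; apply: cvgD; (apply: cvgM; first exact: cvg_cst);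
  by apply: cvgM; [exact: continuous_walk_kernel|exact: continuous_walk_weight].
congr (_ * _); apply: eq_Rintegral => t _.
rewrite walk_weightS ?leq_addr // -/q -/W; symmetry.
transitivity (q * (walk_kernel s.+2 t + walk_kernel s t) * W t
   + (1 - 2 * q) * (walk_kernel s.+1 t * W t)); last by ring.
rewrite walk_kernel_rec [2 * t]mulr_natl cos_mulr2n cos2sin2; ring.
Qed.

Lemma walk_weight_bounds p i m t :
  (forall k, (1 <= k)%N -> 0 <= p k <= 4^-1) ->
  0 <= walk_weight p i m t <=
    expR (- (4 * (\sum_(i.+1 <= l < m.+1) p l) * sin t ^+ 2)).
Proof.
move=> p4; rewrite mulr_sumr mulr_suml -sumrN expR_sum /walk_weight.
have fact l : (1 <= l)%N -> 0 <= 1 - 4 * p l * sin t ^+ 2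
    <= expR (- (4 * p l * sin t ^+ 2)).
  move=> l1; have /andP[p0 p1] := p4 l l1.
  have s1 : sin t ^+ 2 <= 1 by rewrite sin2cos2 lerBlDr lerDl sqr_ge0.
  have s0 := sqr_ge0 (sin t).
  rewrite expR_ge1Dx andbT subr_ge0; apply: mulr_ile1 => //; lra.
apply/andP; split.
  rewrite big_nat; apply: prodr_ge0 => l /andP[il _].
  by case/andP: (fact l (leq_ltn_trans (leq0n _) il)).
rewrite !big_nat; apply: ler_prod => l /andP[il _].
exact: fact (leq_ltn_trans (leq0n _) il).
Qed.

Lemma continuous_cos_gauss (c : R) :
  continuous (fun t => cos t * expR (- (c * sin t) ^+ 2)).
Proof.
have cF : continuous (fun t => c * sin t).
  by move=> t; apply: cvgM; [exact: cvg_cst|exact: continuous_sin].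
move=> t; apply: cvgM; first exact: continuous_cos.
exact: (continuous_comp (cF t) (@continuous_gauss_fun R _)).
Qed.

(** By the substitution [u = c * sin t], the integral is [c^-1] times that of
[expR (- u ^+ 2)] over [[0, c]], which is less than over the half-line. *)
Lemma Rintegral_cos_gauss (c : R) : 0 < c ->
  I (fun t => cos t * expR (- (c * sin t) ^+ 2)) <= Num.sqrt pi / (2 * c).
Proof.
move=> c0; have pi20 : 0 < pi / 2 :> R by rewrite divr_gt0 // pi_gt0.
have dF t : is_derive t 1 (fun t => c * sin t) (c * cos t).
  exact: is_derive_eq.
have cF : continuous (fun t => c * sin t).
  by move=> t; apply/differentiable_continuous/derivable1_diffP; case: (dF t).
have DF : (fun t => c * sin t)^`()%classic = fun t => c * cos t.
  by apply/funext => t; rewrite derive1E; case: (dF t).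
have cDF : continuous (fun t => c * cos t).
  by move=> t; apply: cvgM; [exact: cvg_cst|exact: continuous_cos].
have cg : continuous (@gauss_fun R) := @continuous_gauss_fun R.
have cgF := @continuous_cos_gauss c.
have subst : (\int[mu]_(u in `[0%R, c]) (gauss_fun u)%:E)%E =
   (c * I (fun t => cos t * expR (- (c * sin t) ^+ 2)))%:E.
  have := @integration_by_substitution_increasing R (fun t => c * sin t)
    gauss_fun 0 (pi / 2) (ltW pi20).
  rewrite sin0 mulr0 sin_pihalf mulr1 DF => ->.
  - rewrite -RintegralZl //; last exact: continuous_itv_integrable.
    rewrite /Rintegral fineK; last first.
      apply: integrable_fin_num => //; apply: continuous_itv_integrable => t.
      by apply: cvgM; [exact: cvg_cst|exact: cgF].
    apply: eq_integral => t _; congr EFin; rewrite /= /gauss_fun /=.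
    by rewrite !fctE; ring.
  - have sub (u : R) : u \in `[0, pi / 2] -> u \in `[- (pi / 2), pi / 2].
      by rewrite !in_itv /= => /andP[u0 ->]; rewrite andbT; apply: le_trans u0; rewrite oppr_le0; exact: ltW.
    by move=> u v /sub uI /sub vI uv; rewrite ltr_pM2l // ltr_sin.
  - by move=> t _; exact: cDF.
  - by apply/cvg_ex; exists (c * cos 0); apply: cvg_at_right_filter; exact: cDF.
  - by apply/cvg_ex; exists (c * cos (pi / 2)); apply: cvg_at_left_filter; exact: cDF.
  - split; first by move=> t _; case: (dF t).
    + by apply: cvg_at_right_filter; exact: cF.
    + by apply: cvg_at_left_filter; exact: cF.
  - exact: continuous_subspaceT.
have : ((c * I (fun t => cos t * expR (- (c * sin t) ^+ 2)))%:E
     <= (Num.sqrt pi / 2)%:E)%E.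
  rewrite -subst -integral0y_gauss; apply: ge0_subset_integral => //.
  - apply: (measurable_int mu (f := EFin \o gauss_fun)); exact: (integrableS _ _ _ integrableT_gauss).
  - by move=> t _; rewrite lee_fin gauss_fun_ge0.
  - exact: subset_itvl.
rewrite lee_fin => h; rewrite invfM mulrA ler_pdivlMr // mulrC //.
Qed.

End survival_integral.

(** * The bound of the survival probability by [sigma] *)

Section survival_bound.
Variable R : realType.

Lemma sigma_ge0 (v : R) : 0 <= sigma v.
Proof.
rewrite /sigma; case: ifP => _; first exact: ler01.
by rewrite le_min ler01 invr_ge0 sqrtr_ge0.
Qed.

Lemma sigma_le1 (v : R) : sigma v <= 1.
Proof. by rewrite /sigma; case: ifP => _; rewrite ?ge_min lexx. Qed.

Lemma sigma_small (eps v : R) : 0 < eps -> eps ^- 2 <= v -> sigma v <= eps.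
Proof.
move=> e0 ev; have v0 : 0 < v by apply: lt_le_trans ev; rewrite invr_gt0 exprn_gt0.
rewrite /sigma gt_eqF // ge_min; apply/orP; right.
rewrite -[leRHS]invrK lef_pV2 ?posrE ?invr_gt0 ?sqrtr_gt0 ?mulr_gt0 ?pi_gt0 //.
have -> : eps^-1 = Num.sqrt (eps ^- 2).
  by rewrite -exprVn sqrtr_sqr ger0_norm // invr_ge0 ltW.
apply: ler_wsqrtr; apply: (le_trans ev).
apply: ler_peMl; first exact: ltW.
by apply: le_trans (pi_ge2 R); rewrite ler1n.
Qed.

Lemma cvg_sigma_pinfty (v : nat -> R) :
  v n @[n --> \oo] --> +oo -> sigma (v n) @[n --> \oo] --> (0 : R).
Proof.
move=> /cvgryPge vy; apply/cvgr0Pnorm_le => eps e0.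
near=> n; rewrite ger0_norm ?sigma_ge0 //; apply: sigma_small => //.
by near: n; exact: vy.
Unshelve. all: end_near. Qed.

(** The bound on [p] is that of [a * (1 - a)]; it makes all the factors of
[walk_weight] nonnegative. *)
Lemma survival_le_sigma (p : nat -> R) (i m : nat) :
  (i <= m)%N -> (forall k, (1 <= k)%N -> 0 <= p k <= 4^-1) ->
  survival p i m 1 <= sigma (\sum_(i.+1 <= l < m.+1) p l).
Proof.
move=> im p4; set v := \sum_(_ <= _ < _) _.
have v0 : 0 <= v.
  rewrite /v big_nat; apply: sumr_ge0 => l /andP[il _].
  by case/andP: (p4 l (leq_ltn_trans (leq0n _) il)).
have s1 : survival p i m 1 <= 1.
  have p2 k : (1 <= k)%N -> 0 <= p k <= 2^-1.
    by move=> /p4 /andP[-> pk] /=; apply: le_trans pk _; lra.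
  by case/andP: (survival_bounds i m 1 p2).
rewrite /sigma; case: ifPn => // vn0; rewrite le_min s1 /=.
have {vn0}v0 : 0 < v by rewrite lt_neqAle eq_sym vn0.
have c0 : 0 < 2 * Num.sqrt v by rewrite mulr_gt0 ?sqrtr_gt0.
rewrite survival_integral //.
apply: (@le_trans _ _ (2 / pi * (2 * (Num.sqrt pi / (2 * (2 * Num.sqrt v)))))).
  rewrite ler_wpM2l ?divr_ge0 ?pi_ge0 //.
  apply: le_trans (ler_wpM2l _ (Rintegral_cos_gauss c0)); last by [].
  rewrite -RintegralZl //; last first.
    by apply: continuous_itv_integrable; exact: continuous_cos_gauss.
  apply: le_Rintegral => //.
  - apply: continuous_itv_integrable => t; apply: cvgM.
      exact: continuous_walk_kernel.
    exact: continuous_walk_weight.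
  - apply: continuous_itv_integrable => t; apply: cvgM; first exact: cvg_cst.
    exact: continuous_cos_gauss.
  move=> t; rewrite /= in_itv /= => /andP[t0 t1].
  have cos0 : 0 <= cos t.
    apply: cos_ge0_pihalf; rewrite t1 andbT; apply: le_trans t0.
    by rewrite oppr_le0 divr_ge0 ?pi_ge0.
  have /andP[w0 w1] := walk_weight_bounds i m t p4.
  (* One factor [cos t] is dropped; the other is the derivative needed for the
     Gaussian substitution. *)
  rewrite walk_kernel1 -mulrA ler_wpM2l //; apply: ler_pM; rewrite ?sqr_ge0 //.
    by rewrite expr2 ler_piMr // cos_le1.
  suff -> : (2 * Num.sqrt v * sin t) ^+ 2 = 4 * v * sin t ^+ 2 by [].
  by rewrite !exprMn sqr_sqrtr ?ltW // -natrX.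
have sp : 0 < Num.sqrt (pi : R) by rewrite sqrtr_gt0 pi_gt0.
have sv : 0 < Num.sqrt v by rewrite sqrtr_gt0.
rewrite sqrtrM ?pi_ge0 //; set P : R := Num.sqrt pi in sp *.
have -> : (pi : R) = P ^+ 2 by rewrite sqr_sqrtr ?pi_ge0.
rewrite le_eqVlt; apply/orP; left; apply/eqP; field.
by rewrite !gt_eqF.
Qed.

End survival_bound.

(** * Convergence of weighted sums *)

Section convergence.
Variable R : realType.

Lemma cvg0_add (f g : nat -> R) :
  f n @[n --> \oo] --> (0 : R) -> g n @[n --> \oo] --> (0 : R) ->
  f n + g n @[n --> \oo] --> (0 : R).
Proof. by move=> f0 g0; have := cvgD f0 g0; rewrite addr0; apply. Qed.

Lemma cvg0_mull (k : R) (f : nat -> R) :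
  f n @[n --> \oo] --> (0 : R) -> k * f n @[n --> \oo] --> (0 : R).
Proof. by move=> f0; have := cvgM (cvg_cst k) f0; rewrite mulr0; apply. Qed.

(** Dominated convergence for series (Tannery's theorem), with limit 0. *)
Lemma cvg_weighted_sum0 (w : nat -> R) (s : nat -> nat -> R) (L : R) :
  (forall k, (1 <= k)%N -> 0 <= w k) ->
  (\sum_(1 <= k < n.+1) w k) @[n --> \oo] --> L ->
  (forall n i, 0 <= s n i <= 1) ->
  (forall i, s n i @[n --> \oo] --> (0 : R)) ->
  (\sum_(1 <= i < n.+1) w i * s n i) @[n --> \oo] --> (0 : R).
Proof.
move=> w0 wL s01 s0; set S := fun n => \sum_(1 <= k < n.+1) w k.
have Sadd N n : (N <= n)%N -> S n = S N + \sum_(N.+1 <= k < n.+1) w k.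
  by move=> Nn; rewrite /S (big_cat_nat (n := N.+1)).
have tail0 N n : 0 <= \sum_(N.+1 <= k < n.+1) w k.
  rewrite big_nat; apply: sumr_ge0 => k /andP[Nk _].
  exact: w0 (leq_ltn_trans (leq0n _) Nk).
have SL n : S n <= L.
  rewrite -(cvg_lim _ wL) //; apply: (nondecreasing_cvgn_le (u_ := S)).
    by move=> a b ab; rewrite (Sadd _ _ ab) lerDl.
  by apply/cvg_ex; exists L.
have head0 N : (\sum_(1 <= i < N.+1) w i * s n i) @[n --> \oo] --> (0 : R).
  elim: N => [|N IH].
    by under eq_fun do rewrite big_geq //; exact: cvg_cst.
  under eq_fun do rewrite big_nat_recr //=.
  by apply: cvg0_add; [exact: IH|apply: cvg0_mull; exact: s0].
apply/cvgr0Pnorm_lt => eps e0; have e20 : 0 < eps / 2 by rewrite divr_gt0.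
have /cvgrPdist_lt /(_ _ e20) [N _ /(_ N (leqnn N)) /= hN] := wL.
have {}hN : L - S N < eps / 2 by apply: le_lt_trans hN; exact: ler_norm.
near=> n.
have Nn : (N <= n)%N by near: n; exact: nbhs_infty_ge.
have hn : `|\sum_(1 <= i < N.+1) w i * s n i| < eps / 2.
  by near: n; have /cvgr0Pnorm_lt := head0 N; apply.
rewrite (big_cat_nat (n := N.+1)) //=; apply: le_lt_trans (ler_normD _ _) _.
have ws k : (1 <= k)%N -> 0 <= w k * s n k <= w k.
  move=> k1; have /andP[a b] := s01 n k.
  by rewrite mulr_ge0 ?w0 //= ler_piMr ?w0.
have tail : `|\sum_(N.+1 <= i < n.+1) w i * s n i| <= S n - S N.
  rewrite (Sadd _ _ Nn) addrAC subrr add0r ger0_norm.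
    rewrite !big_nat; apply: ler_sum => k /andP[Nk _].
    by case/andP: (ws k (leq_ltn_trans (leq0n _) Nk)).
  rewrite big_nat; apply: sumr_ge0 => k /andP[Nk _].
  by case/andP: (ws k (leq_ltn_trans (leq0n _) Nk)).
have := SL n; lra.
Unshelve. all: end_near. Qed.

Lemma nneseries_lty_cvg (w : nat -> R) :
  (forall k, (1 <= k)%N -> 0 <= w k) ->
  (\sum_(1 <= k <oo) (w k)%:E < +oo)%E ->
  exists L : R, (\sum_(1 <= k < n.+1) w k) @[n --> \oo] --> L.
Proof.
move=> w0 wfin; apply/cvg_ex; apply: nondecreasing_is_cvgn.
  move=> a b ab; rewrite [leRHS](big_cat_nat (n := a.+1)) //= lerDl big_nat.
  apply: sumr_ge0 => k /andP[ak _].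
  exact: w0 (leq_ltn_trans (leq0n _) ak).
have w0E k : (1 <= k)%N -> xpredT k -> (0 <= (w k)%:E)%E.
  by move=> k1 _; rewrite lee_fin w0.
exists (fine (\sum_(1 <= k <oo) (w k)%:E)%E) => _ [n _ <-].
have := nneseries_lim_ge n.+1 w0E; rewrite sumEFin => h.
rewrite -lee_fin fineK // ge0_fin_numE // (le_trans _ h) // lee_fin.
by rewrite big_nat; apply: sumr_ge0 => k /andP[k1 _]; exact: w0.
Qed.

Lemma nneseries_pinfty_cvg (w : nat -> R) :
  (forall k, (1 <= k)%N -> 0 <= w k) ->
  (\sum_(1 <= k <oo) (w k)%:E = +oo)%E ->
  (\sum_(1 <= k < n.+1) w k) @[n --> \oo] --> +oo.
Proof.
move=> w0 winf; apply/cvgeryP.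
have w0E k : (1 <= k)%N -> xpredT k -> (0 <= (w k)%:E)%E.
  by move=> k1 _; rewrite lee_fin w0.
have := is_cvg_nneseries w0E; rewrite winf => h.
under eq_fun do rewrite -sumEFin.
by rewrite -(cvg_shiftS (fun n => \sum_(1 <= i < n) (w i)%:E)%E) in h.
Qed.

End convergence.

(** * Bounded convex sets *)

Section bounded_convex.
Variables (R : realType) (X : normedModType R) (C : set X).

Lemma norm_le_diam (u v : X) : bounded_set C -> C u -> C v -> `|u - v| <= diam C.
Proof.
move=> [M [_ hM]] Cu Cv; apply: ub_le_sup; last by exists u => //; exists v.
have {}hM z : C z -> `|z| <= M + 1 by apply: hM; rewrite ltrDl.
exists (M + 1 + (M + 1)) => _ [a Ca [b Cb <-]].
by apply: le_trans (ler_normB _ _) _; apply: lerD; exact: hM.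
Qed.

Lemma convex_set_conv (a : R) (u v : X) : convex_set C -> 0 <= a <= 1 ->
  C u -> C v -> C ((1 - a) *: u + a *: v).
Proof.
move=> cC /andP[a0 a1] Cu Cv.
have := cC v u (Itv01 a0 a1) (mem_set Cv) (mem_set Cu).
by rewrite addrC => /set_mem.
Qed.

End bounded_convex.

(** * The Ishikawa iteration *)

Theorem corollary4p4 (R : realType) (X : completeNormedModType R)
    (C : set X) (C_bounded : bounded_set C) (C_closed : closed C)
    (C_convex : convex_set C)
    (T : {fun C >-> C}) (T_nonexpansive : nonexpansive C T)
    (alpha beta : nat -> R)
    (alpha01 : forall n : nat, (1 <= n)%N -> 0 < alpha n < 1)
    (beta01 : forall n : nat, (1 <= n)%N -> 0 < beta n < 1)
    (x0 : X) (Cx0 : C x0)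
    (x y : nat -> X)
    (x_init : x 0%N = x0)
    (y_def : forall n : nat,
      y n = (1 - beta n.+1) *: x n + beta n.+1 *: T (x n))
    (x_rec : forall n : nat,
      x n.+1 = (1 - alpha n.+1) *: x n + alpha n.+1 *: T (y n))
    (beta_to0 : beta n @[n --> \oo] --> (0 : R))
    (alpha_beta_summable :
      (\sum_(1 <= k <oo) (alpha k * beta k)%:E < +oo)%E)
    (tau_diverges :
      (\sum_(1 <= k <oo) (alpha k * (1 - alpha k))%:E = +oo)%E) :
  (`|x n - T (x n)| @[n --> \oo] --> (0 : R)) /\
  (forall n : nat,
    `|x n - T (x n)| <=
    diam C * (sigma (tau alpha n)
              + \sum_(1 <= i < n.+1)
                  2 * alpha i * beta i * sigma (tau alpha n - tau alpha i)
              + 2 * beta n.+1)).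

Proof.
have a01 k : (1 <= k)%N -> 0 <= alpha k <= 1.
  by move=> /alpha01 /andP[/ltW -> /ltW ->].
have b01 k : (1 <= k)%N -> 0 <= beta k <= 1.
  by move=> /beta01 /andP[/ltW -> /ltW ->].
pose p k := alpha k * (1 - alpha k).
have p4 k : (1 <= k)%N -> 0 <= p k <= 4^-1.
  move=> /a01 /andP[a0 a1]; rewrite mulr_ge0 ?subr_ge0 //= /p.
  by have := sqr_ge0 (alpha k - 2^-1); rewrite expr2; lra.
have ab0 k : (1 <= k)%N -> 0 <= alpha k * beta k.
  by move=> k1; case/andP: (a01 k k1) (b01 k k1) => ? _ /andP[? _]; exact: mulr_ge0.
have T_in_C u : C u -> C (T u) by move=> Cu; exact: funS.
have Cx n : C (x n).
  elim: n => [|n Cxn]; first by rewrite x_init.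
  rewrite x_rec; apply: convex_set_conv => //; first exact: a01.
  suff Cyn : C (y n) by exact: T_in_C.
  by rewrite y_def; apply: convex_set_conv => //; [exact: b01|exact: T_in_C].
have Cy n : C (y n).
  by rewrite y_def; apply: convex_set_conv => //; [exact: b01|exact: T_in_C].
have diamP u v := @norm_le_diam R X C u v C_bounded.
have diam0 : 0 <= diam C by apply: le_trans (diamP _ _ Cx0 Cx0).
(* The inner step moves [x n] by at most [beta n.+1] times the diameter. *)
have TyTx n : `|T (y n) - T (x n)| <= diam C * beta n.+1.
  apply: le_trans (T_nonexpansive _ _ (Cy n) (Cx n)) _.
  have /andP[b0 _] := b01 n.+1 isT.
  rewrite y_def scalerBl scale1r addrC !addrA addNr add0r addrC -scalerBr normrZ.
  by rewrite ger0_norm // mulrC ler_wpM2r //; apply: diamP => //; exact: T_in_C.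
have tauB n i : (i <= n)%N ->
    tau alpha n - tau alpha i = \sum_(i.+1 <= l < n.+1) p l.
  by move=> ni; rewrite /tau (big_cat_nat (n := i.+1)) //= addrAC subrr add0r.
have bound n : `|x n - T (x n)| <= diam C * (sigma (tau alpha n)
    + \sum_(1 <= i < n.+1)
        2 * alpha i * beta i * sigma (tau alpha n - tau alpha i)
    + 2 * beta n.+1).
  have := @dist_iterate_next R X (diam C) alpha (fun k => diam C * beta k) x
    (fun k => T (y k)) a01 _ x_rec _ _ n.
  have e0 k : (1 <= k)%N -> 0 <= diam C * beta k.
    by move=> /b01 /andP[? _]; exact: mulr_ge0.
  have zz i k : `|T (y i) - T (y k)|
      <= `|x i - x k| + diam C * beta i.+1 + diam C * beta k.+1.
    have h1 := T_nonexpansive _ _ (Cx i) (Cx k).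
    have h2 := TyTx i; have h3 := TyTx k; rewrite distrC in h3.
    have t1 := ler_distD (T (x i)) (T (y i)) (T (y k)).
    have t2 := ler_distD (T (x k)) (T (x i)) (T (y k)).
    lra.
  have x0z k : `|x 0%N - T (y k)| <= diam C by apply: diamP => //; exact: T_in_C.
  move=> /(_ e0 zz x0z) h.
  have t1 := ler_distD (T (y n)) (x n) (T (x n)).
  have h2 := TyTx n.
  have s0 : diam C * survival p 0 n 1 <= diam C * sigma (tau alpha n).
    by apply: ler_wpM2l => //; exact: survival_le_sigma.
  have si : \sum_(1 <= i < n.+1) 2 * alpha i * (diam C * beta i) * survival p i n 1
     <= diam C * \sum_(1 <= i < n.+1)
        2 * alpha i * beta i * sigma (tau alpha n - tau alpha i).
    rewrite mulr_sumr !big_nat; apply: ler_sum => i /andP[i1 ni].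
    rewrite tauB //.
    rewrite (_ : 2 * alpha i * (diam C * beta i) = diam C * (2 * alpha i * beta i));
      last by ring.
    rewrite -mulrA ler_wpM2l // ler_wpM2l ?survival_le_sigma //.
    by rewrite -mulrA mulr_ge0 // ab0.
  rewrite !mulrDr; rewrite -/p in h; lra.
split=> //.
have tauy : tau alpha n @[n --> \oo] --> +oo.
  apply: nneseries_pinfty_cvg tau_diverges => k k1.
  by case/andP: (p4 k k1).
have [L abL] := nneseries_lty_cvg ab0 alpha_beta_summable.
have bnd0 : (diam C * (sigma (tau alpha n)
    + \sum_(1 <= i < n.+1)
        2 * alpha i * beta i * sigma (tau alpha n - tau alpha i)
    + 2 * beta n.+1)) @[n --> \oo] --> (0 : R).
  have sum0 : (\sum_(1 <= i < n.+1)
        2 * alpha i * beta i * sigma (tau alpha n - tau alpha i)) @[n --> \oo] --> (0 : R).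
    apply: (@cvg_weighted_sum0 _ (fun i => 2 * alpha i * beta i)
       (fun n i => sigma (tau alpha n - tau alpha i)) (2 * L)).
    - by move=> k k1; rewrite -mulrA mulr_ge0 // ab0.
    - under eq_fun => n.
        under eq_bigr do rewrite -mulrA.
        rewrite -mulr_sumr; over.
      by apply: cvgM; [exact: cvg_cst|exact: abL].
    - by move=> n i; rewrite sigma_ge0 sigma_le1.
    - move=> i; apply: cvg_sigma_pinfty; apply/cvgryPge => A.
      near=> n; rewrite lerBrDr; near: n.
      by move/cvgryPge : tauy; apply.
  have b0 : 2 * beta n.+1 @[n --> \oo] --> (0 : R).
    by apply: cvg0_mull; rewrite (cvg_shiftS beta).
  apply: cvg0_mull; apply: cvg0_add; last exact: b0.
  by apply: cvg0_add; [exact: cvg_sigma_pinfty|exact: sum0].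
apply: squeeze_cvgr (cvg_cst 0) bnd0.
by near=> n; rewrite normr_ge0 bound.
Unshelve. all: end_near. Qed.
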